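(* Let $n\ge 5$, let $p_1,\ldots,p_n\in\mathbb{R}^2$, and let $d_{\{i,j\}}=\|p_i-p_j\|^2$ be the square of the Euclidean distance between $p_i$ and $p_j$, for every $\{i,j\}\in\mathcal{P}$, where $\mathcal{P}$ is the set of two-element subsets of $\{1,\ldots,n\}$. Let $g$ be the polynomial in six variables given in the context. Suppose that for each choice of indices $i_0,i_1,i_2,j_1,j_2,k_1,k_2,l_1,l_2,m_1,m_2\in\{1,\ldots,n\}$ such that $\{i_0,i_1\},\{i_0,i_2\},\{j_1,j_2\},\{k_1,k_2\},\{l_1,l_2\},\{m_1,m_2\}$ are six distinct elements of $\mathcal{P}$, we have $$g\left(d_{\{i_0,i_1\}},d_{\{j_1,j_2\}},d_{\{k_1,k_2\}},d_{\{l_1,l_2\}},d_{\{m_1,m_2\}},d_{\{i_0,i_2\}}\right)\neq 0.$$ Then the $n$-point configuration $p_1,\ldots,p_n$ is reconstructible from distances.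
   Context: $\mathcal{P}=\{\{i,j\} : i\neq j,\ i,j=1,\ldots,n\}$. The polynomial $g$ is \begin{align*} g(U,V,W,X,Y,Z) := {}& 2U^2Z+2UVX-2UVY-2UVZ-2UXW-2UXZ+2UYW\\ &-2UYZ-2UWZ+2UZ^2+2V^2Y-2VXY-2VXW+2VY^2-2VYW\\ &-2VYZ+2VWZ+2X^2W-2XYW+2XYZ+2XW^2-2XWZ. \end{align*} The distribution of distances of a configuration $p_1,\ldots,p_n\in\mathbb{R}^m$ is the multiset of the pairwise distances $\|p_i-p_j\|$, $\{i,j\}\in\mathcal{P}$ (i.e. the list of the values occurring together with the number of times each occurs). A rigid motion of $\mathbb{R}^m$ is a pair $(M,T)$ with $M$ an orthogonal $m\times m$ matrix and $T\in\mathbb{R}^m$, acting by $x\mapsto Mx+T$. A configuration $p_1,\ldots,p_n\in\mathbb{R}^m$ is called reconstructible from distances if, for every $q_1,\ldots,q_n\in\mathbb{R}^m$ having the same distribution of distances, there exist a rigid motion $(M,T)$ and a permutation $\pi$ of $\{1,\ldots,n\}$ such that $Mp_i+T=q_{\pi(i)}$ for every $i=1,\ldots,n$. Here $m=2$. *)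

(* Defs.v *)
From mathcomp Require Import all_boot all_order all_algebra all_fingroup.
From mathcomp Require Import reals.

Set Implicit Arguments.
Unset Strict Implicit.
Unset Printing Implicit Defensive.

Import Order.TTheory GRing.Theory Num.Theory.
Local Open Scope ring_scope.

Definition pairs (n : nat) : {set {set 'I_n}} :=
  [set [set i; j] | i in 'I_n, j in 'I_n & i != j].

(* The norm that MathComp-Analysis puts on matrices is the max norm, hence
   this separate definition. *)
Definition enorm (R : realType) (m : nat) (x : 'cV[R]_m) : R :=
  Num.sqrt (\sum_(k < m) x k 0 ^+ 2).

Definition dist (R : realType) (m : nat) (x y : 'cV[R]_m) : R := enorm (x - y).

(* Each element {i, j} of [pairs n] is listed once, as the ordered pair with
   i < j. A multiset is a list up to [perm_eq]. *)
Definition distances (R : realType) (m n : nat) (p : 'I_n -> 'cV[R]_m) : seq R :=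
  [seq dist (p ij.1) (p ij.2) | ij <- enum [pred ij : 'I_n * 'I_n | (ij.1 < ij.2)%N]].

Definition same_distribution (R : realType) (m n : nat)
    (p q : 'I_n -> 'cV[R]_m) : bool :=
  perm_eq (distances p) (distances q).

Definition orthogonal_mx (R : realType) (m : nat) (M : 'M[R]_m) : Prop :=
  M^T *m M = 1%:M.

Definition reconstructible (R : realType) (m n : nat)
    (p : 'I_n -> 'cV[R]_m) : Prop :=
  forall q : 'I_n -> 'cV[R]_m, same_distribution p q ->
  exists (M : 'M[R]_m) (T : 'cV[R]_m) (s : 'S_n),
    orthogonal_mx M /\ forall i : 'I_n, M *m p i + T = q (s i).

Definition g (R : comNzRingType) (U V W X Y Z : R) : R :=
  2 * U ^+ 2 * Z + 2 * U * V * X - 2 * U * V * Y - 2 * U * V * Z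
  - 2 * U * X * W - 2 * U * X * Z + 2 * U * Y * W
  - 2 * U * Y * Z - 2 * U * W * Z + 2 * U * Z ^+ 2 + 2 * V ^+ 2 * Y
  - 2 * V * X * Y - 2 * V * X * W + 2 * V * Y ^+ 2 - 2 * V * Y * W
  - 2 * V * Y * Z + 2 * V * W * Z + 2 * X ^+ 2 * W - 2 * X * Y * W
  + 2 * X * Y * Z + 2 * X * W ^+ 2 - 2 * X * W * Z.

(* Main.v *)
(** The polynomial g is the Cayley-Menger determinant of four points, its first
    and last arguments being squared lengths of opposite edges, so it vanishes
    on planar points. If q has the same distances as p, these are matched by a
    permutation psi of the edges of K_n. Were psi to send two disjoint edges to
    adjacent ones, the vanishing of g on the four endpoints in q would
    contradict the hypothesis on p. So psi preserves disjointness, and as there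
    are finitely many edges it preserves adjacency as well. For n >= 5 it is
    therefore induced by a permutation of the vertices; after relabelling, p and
    q have equal distances pairwise, and are congruent. *)

Require Import Defs.
From mathcomp Require Import all_boot all_order all_algebra all_fingroup.
From mathcomp Require Import reals.
From mathcomp Require Import ring lra.

Set Implicit Arguments.
Unset Strict Implicit.
Unset Printing Implicit Defensive.

Import Order.TTheory GRing.Theory Num.Theory.

(** * Families with the same multiset of values *)

Lemma perm_map_reindex (I T : eqType) (s : seq I) (f h : I -> T) :
  uniq s -> perm_eq (map f s) (map h s) ->
  exists phi : I -> I, [/\ {in s, forall x, phi x \in s},
    {in s &, injective phi} & {in s, forall x, h x = f (phi x)}].
Proof.
case: s => [|x0 s'] us; first by exists id.
move: (x0 :: s') us => {}s us.
rewrite perm_sym => /(perm_iotaP (f x0)) [js pjs hE].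
(* [t] is [s] rearranged so that [h] along [s] reads as [f] along [t]; [phi] will send each entry of
   [s] to the entry of [t] at the same position. *)
pose t := map (nth x0 s) js.
have pt : perm_eq t s.
  by rewrite -[X in perm_eq _ X](mkseq_nth x0) perm_map // -(size_map f).
have hf : map h s = map f t.
  rewrite hE -map_comp; apply/eq_in_map => i.
  by rewrite (perm_mem pjs) mem_iota size_map => /= hi; rewrite (nth_map x0).
have st := perm_size pt.
have ix x : x \in s -> (index x s < size t)%N by rewrite st index_mem.
exists (fun x => nth x0 t (index x s)); split.
- by move=> x xs; rewrite -(perm_mem pt) mem_nth ?ix.
- move=> x y xs ys /eqP; rewrite nth_uniq ?ix ?(perm_uniq pt) // => /eqP e.
  by rewrite -(nth_index x0 xs) e nth_index.
- move=> x xs; rewrite -(nth_map _ (f x0)) ?ix // -hf (nth_map x0) ?nth_index //.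
  by rewrite index_mem.
Qed.

(** * Combinatorics of two-element sets: from edge maps to vertex permutations *)

Section TwoSets.
Variables (T : finType).
Implicit Types A B C D : {set T}.

Lemma disjoint_preserved_iff (P : {set {set T}}) (phi : {set T} -> {set T}) :
  {in P, forall A, phi A \in P} -> {in P &, injective phi} ->
  {in P &, forall A B, [disjoint A & B] -> [disjoint phi A & phi B]} ->
  {in P &, forall A B, [disjoint phi A & phi B] = [disjoint A & B]}.
Proof.
move=> phiP inj disj A B AP BP; apply/idP/idP => [|/disj]; last exact.
move=> dAB; pose X := [set u | [&& u.1 \in P, u.2 \in P & [disjoint u.1 & u.2]]].
pose F u := (phi u.1, phi u.2).
have injF : {in X &, injective F}.
  move=> [x y] [z t]; rewrite !inE /= => /and3P[xP yP _] /and3P[zP tP _].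
  by case=> /inj -> // /inj ->.
have FX : F @: X \subset X.
  apply/subsetP => _ /imsetP[[x y]] + ->; rewrite !inE /= => /and3P[xP yP d].
  by rewrite !phiP //= disj.
(* A finite set has no injection onto a proper subset, so phi reflects
   disjointness too. *)
have FE : F @: X = X by apply/eqP; rewrite eqEcard FX card_in_imset /=.
have : F (A, B) \in X by rewrite inE /= !phiP.
rewrite -FE => /imsetP[[x y]]; rewrite inE /= => /and3P[xP yP d].
by case=> /inj -> // /inj ->.
Qed.

Lemma cards2_mem A w : #|A| = 2 -> w \in A -> exists2 a, a != w & A = [set w; a].
Proof.
move/eqP/cards2P => [x [y [xy ->]]]; rewrite !inE => /orP[]/eqP e; subst w.
  by exists y; rewrite // eq_sym.
by exists x; rewrite // setUC.
Qed.

(** If [w] is not in [C], then with [A = {w, a}] and [B = {w, b}] meeting both forces [C = {a, b}],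
    a triangle. A pair that meets all three sides of a triangle is one of them, so [D] cannot be a
    fourth set: it is [D] that tells a star from a triangle. *)
Lemma intersecting_star A B C D w :
  #|A| = 2 -> #|B| = 2 -> #|C| = 2 -> #|D| = 2 -> uniq [:: A; B; C; D] ->
  ~~ [disjoint A & C] -> ~~ [disjoint A & D] -> ~~ [disjoint B & C] ->
  ~~ [disjoint B & D] -> ~~ [disjoint C & D] ->
  w \in A -> w \in B -> w \in C.
Proof.
move=> A2 B2 C2 D2 uABCD AC AD BC BD CD wA wB; apply: contraT => wC.
have [a aw EA] := cards2_mem A2 wA; have [b bw EB] := cards2_mem B2 wB.
have ab : a != b by apply: contraTneq uABCD => E; rewrite /= EA EB E !inE eqxx.
have meet x y (E : {set T}) : x \notin E ->
    ~~ [disjoint [set x; y] & E] -> y \in E.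
  move=> xE; apply: contraR => yE; rewrite -setI_eq0; apply/eqP/setP => z.
  rewrite !inE; apply/negP => /andP[/orP[]/eqP-> zE]; last by rewrite zE in yE.
  by rewrite zE in xE.
have two x y (E : {set T}) : #|E| = 2 -> x != y ->
    x \in E -> y \in E -> E = [set x; y].
  move=> E2 xy xE yE; apply/esym/eqP; rewrite eqEcard E2 cards2 xy andbT.
  by apply/subsetP => z; rewrite !inE => /orP[]/eqP->.
have aC : a \in C by apply: meet wC _; rewrite -EA.
have bC : b \in C by apply: meet wC _; rewrite -EB.
have EC := two _ _ _ C2 ab aC bC.
have [wD|wD] := boolP (w \in D).
  have [aD|aD] := boolP (a \in D).
    have ED := two w a D D2; rewrite eq_sym in ED.
    by move: uABCD; rewrite /= (ED aw wD aD) -EA !inE eqxx !orbT.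
  have bD : b \in D by apply: meet aD _; rewrite -EC.
  have ED := two w b D D2; rewrite eq_sym in ED.
  by move: uABCD; rewrite /= (ED bw wD bD) -EB !inE eqxx !orbT andbF.
have aD : a \in D by apply: meet wD _; rewrite -EA.
have bD : b \in D by apply: meet wD _; rewrite -EB.
by move: uABCD; rewrite /= (two a b D D2 ab aD bD) -EC !inE eqxx !andbF.
Qed.

Lemma exists_fresh (s : seq T) : (size s < #|T|)%N -> exists x, x \notin s.
Proof.
move=> hs; apply/existsP; apply: contraTT hs; rewrite negb_exists => /forallP h.
rewrite -leqNgt; apply: leq_trans (card_size s); apply: subset_leq_card.
by apply/subsetP => x _; have := h x; rewrite negbK.
Qed.

(* Whitney's theorem on line graphs, for K_n. The bound is sharp: for n = 4 a
   permutation of the edges may exchange stars with triangles. *)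
Lemma edge_perm_vertex_perm (phi : {set T} -> {set T}) :
  (5 <= #|T|)%N ->
  (forall A, #|A| = 2 -> #|phi A| = 2) ->
  (forall A B, #|A| = 2 -> #|B| = 2 -> phi A = phi B -> A = B) ->
  (forall A B, #|A| = 2 -> #|B| = 2 -> [disjoint A & B] ->
     [disjoint phi A & phi B]) ->
  exists pi : {perm T}, forall i j, i != j -> phi [set i; j] = [set pi i; pi j].
Proof.
move=> n5 phi2 inj disj.
have c2 (x y : T) : x != y -> #|[set x; y]| = 2 by rewrite cards2 => ->.
have adj v x y : x != v -> y != v ->
    ~~ [disjoint phi [set v; x] & phi [set v; y]].
  move=> xv yv; rewrite (@disjoint_preserved_iff [set A : {set T} | #|A| == 2]).
  - by apply/pred0Pn; exists v; rewrite /= !inE eqxx.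
  - by move=> A; rewrite !inE => /eqP/phi2->.
  - by move=> A B; rewrite !inE => /eqP ? /eqP ?; apply: inj.
  - by move=> A B; rewrite !inE => /eqP ? /eqP ?; apply: disj.
  - by rewrite inE c2 // eq_sym.
  - by rewrite inE c2 // eq_sym.
have star_neq v x y : x != v -> y != v -> x != y ->
    phi [set v; x] != phi [set v; y].
  move=> xv yv; apply: contraNneq => /inj.
  rewrite !c2 1?eq_sym // => /(_ erefl erefl)/setP/(_ x).
  by rewrite !inE eqxx orbT (negbTE xv) eq_sym /= => <-.
(* The images of the edges at [v] meet pairwise. The candidate [w] is a common point of the first
   two images; the edge [{v, x4}] supplies the fourth set that rules out a triangle. Choosing [x4]
   away from [v], [x1], [x2], [x3] is where all five points are needed. *)
have center v : exists w, [forall x, (x != v) ==> (w \in phi [set v; x])].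
  have [x1] : exists x, x \notin [:: v] by exact/exists_fresh/(leq_trans _ n5).
  rewrite !inE => x1v.
  have [x2] : exists x, x \notin [:: v; x1] by exact/exists_fresh/(leq_trans _ n5).
  rewrite !inE negb_or => /andP[x2v x21].
  have /pred0Pn[w /andP[/= w1 w2]] := adj _ _ _ x1v x2v.
  exists w; apply/forallP => x3; apply/implyP => x3v.
  have [->//|x31] := eqVneq x3 x1; have [->//|x32] := eqVneq x3 x2.
  have [x4] : exists x, x \notin [:: v; x1; x2; x3]
    by exact/exists_fresh/(leq_trans _ n5).
  rewrite !inE !negb_or => /and4P[x4v x41 x42 x43].
  apply: (@intersecting_star (phi [set v; x1]) (phi [set v; x2]) _
    (phi [set v; x4])) w1 w2;
    try exact: adj; try by rewrite phi2 // c2 // eq_sym.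
  by rewrite /= !inE !negb_or !star_neq // eq_sym.
pose pi0 v := xchoose (center v).
have piP v x : x != v -> pi0 v \in phi [set v; x].
  by have /forallP/(_ x)/implyP := xchooseP (center v).
(* If pi0 i = pi0 j, the disjoint edges {i, a} and {j, b} have images meeting in
   that point. *)
have pi_inj : injective pi0.
  move=> i j eqij; apply/eqP; apply: contraT => ij.
  have [a] : exists x, x \notin [:: i; j] by exact/exists_fresh/(leq_trans _ n5).
  rewrite !inE negb_or => /andP[ai aj].
  have [b] : exists x, x \notin [:: i; j; a] by exact/exists_fresh/(leq_trans _ n5).
  rewrite !inE !negb_or => /and3P[bi bj ba].
  have : [disjoint phi [set i; a] & phi [set j; b]].
    apply: disj; rewrite ?c2 // 1?eq_sym //; apply/pred0Pn => -[z /=].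
    rewrite !inE => /andP[/orP[]/eqP->]; apply/negP; rewrite negb_or.
      by rewrite ij eq_sym.
    by rewrite aj eq_sym.
  by move/pred0P/(_ (pi0 i)); rewrite /= piP // eqij piP.
exists (perm pi_inj) => i j ij; rewrite !permE; apply/esym/eqP.
rewrite eqEcard phi2 ?c2 ?(inj_eq pi_inj) // andbT.
apply/subsetP => z; rewrite !inE => /orP[]/eqP->; first by rewrite piP // eq_sym.
by rewrite setUC piP.
Qed.
End TwoSets.

(** * Vanishing of [g] in the plane *)

Local Open Scope ring_scope.

(** A polynomial identity in the eight coordinates. For points a, b, c, e the arguments run through
    ab, ac, ae, bc, be, ce, so that the k-th and the (7-k)-th are opposite edges. *)
Lemma g_planar (R : comNzRingType) (a1 a2 b1 b2 c1 c2 e1 e2 : R) :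
  let dd x1 x2 y1 y2 := (x1 - y1) ^+ 2 + (x2 - y2) ^+ 2 in
  g (dd a1 a2 b1 b2) (dd a1 a2 c1 c2) (dd a1 a2 e1 e2)
    (dd b1 b2 c1 c2) (dd b1 b2 e1 e2) (dd c1 c2 e1 e2) = 0.
Proof. by rewrite /g /=; ring. Qed.

(** * Euclidean geometry: reflections and congruence *)

Section Euclid.
Variables (R : realType) (m : nat).
Implicit Types u v w x y a b : 'cV[R]_m.

Definition dot u v : R := \sum_k u k 0 * v k 0.

Lemma trmx_mul_dot u v : u^T *m v = (dot u v)%:M.
Proof.
apply/matrixP => i j; rewrite !ord1 !mxE eqxx mulr1n.
by apply: eq_bigr => k _; rewrite mxE.
Qed.

Lemma dotC u v : dot u v = dot v u.
Proof. by apply: eq_bigr => k _; rewrite mulrC. Qed.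

Lemma dotDr u v w : dot u (v + w) = dot u v + dot u w.
Proof. by rewrite -big_split; apply: eq_bigr => k _; rewrite mxE mulrDr. Qed.

Lemma dotNr u v : dot u (- v) = - dot u v.
Proof. by rewrite -sumrN; apply: eq_bigr => k _; rewrite mxE mulrN. Qed.

Lemma dot_eq0 u : (dot u u == 0) = (u == 0).
Proof.
rewrite psumr_eq0 => [|k _]; last by rewrite -expr2 sqr_ge0.
apply/allP/eqP => [h|-> k _]; last by rewrite mxE mul0r eqxx.
apply/matrixP => i j; rewrite ord1 mxE; apply/eqP.
by have := h i (mem_index_enum _); rewrite mulf_eq0 orbb.
Qed.

Lemma dist_sqr x y : dist x y ^+ 2 = dot (x - y) (x - y).
Proof. by rewrite sqr_sqrtr // sumr_ge0 // => k _; rewrite sqr_ge0. Qed.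

Lemma dist_sym x y : dist x y = dist y x.
Proof.
rewrite /dist /enorm; congr Num.sqrt; apply: eq_bigr => k _.
by rewrite -sqrrN -opprB mxE opprK.
Qed.

Lemma orthogonal_mxM (M N : 'M[R]_m) :
  orthogonal_mx M -> orthogonal_mx N -> orthogonal_mx (M *m N).
Proof.
rewrite /orthogonal_mx trmx_mul => hM hN.
by rewrite -mulmxA (mulmxA M^T) hM mul1mx.
Qed.

Lemma dist_rigid (M : 'M[R]_m) T x y :
  orthogonal_mx M -> dist (M *m x + T) (M *m y + T) = dist x y.
Proof.
move=> hM; apply: (pexpIrn (n := 2)); rewrite ?nnegrE ?sqrtr_ge0 //.
rewrite !dist_sqr opprD addrACA subrr addr0 -mulmxBr.
suff: (dot (M *m (x - y)) (M *m (x - y)))%:M = (dot (x - y) (x - y))%:M :> 'M_1.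
  by move/matrixP/(_ 0 0); rewrite !mxE eqxx !mulr1n.
by rewrite -!trmx_mul_dot trmx_mul -mulmxA (mulmxA M^T) hM mul1mx.
Qed.

(** For distinct points this is the Householder reflection in the perpendicular bisector of [a] and
    [b]; for [a = b] the identity serves. *)
Lemma bisector_reflection a b : exists (M : 'M[R]_m) (T : 'cV[R]_m),
  [/\ orthogonal_mx M, M *m a + T = b &
      forall x, dist x a = dist x b -> M *m x + T = x].
Proof.
have [->|neq] := eqVneq a b.
  exists 1%:M, 0; split=> [||x _]; rewrite ?mul1mx ?addr0 //.
  by rewrite /orthogonal_mx trmx1 mulmx1.
pose w := a - b; pose s := dot w w.
have s0 : s != 0 by rewrite dot_eq0 subr_eq0.
(* [t] is the difference of the squared norms of [a] and [b], so [2 * dot w x - t] is the squared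
   distance from [x] to [b] minus that to [a]. It is zero on the bisector and equals [s] at [a],
   which is thus moved by [- w] to [b]. *)
pose t := dot w (a + b).
pose M := 1%:M - (2 / s) *: (w *m w^T).
have ME x : M *m x + (t / s) *: w = x - ((2 * dot w x - t) / s) *: w.
  rewrite mulmxBl mul1mx -scalemxAl -mulmxA trmx_mul_dot mul_mx_scalar scalerA.
  rewrite mulrBl scalerBl opprB addrA addrAC; congr (_ - _ *: _ + _).
  by rewrite mulrAC.
exists M, ((t / s) *: w); split.
- have MT : M^T = M by rewrite linearB linearZ /= trmx1 trmx_mul trmxK.
  rewrite /orthogonal_mx MT mulmxBl mul1mx -scalemxAl mulmxBr mulmx1.
  rewrite -scalemxAr mulmxA -(mulmxA w) trmx_mul_dot mul_mx_scalar -scalemxAl.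
  rewrite -/s scalerA divfK // scaler_nat mulr2n opprD addrA subrr add0r.
  by rewrite scalerN opprK subrK.
- rewrite ME (_ : 2 * dot w a - t = s); first by rewrite divff // scale1r subKr.
  by rewrite /t /s !dotDr dotNr; ring.
- move=> x /(congr1 (fun r => r ^+ 2)); rewrite !dist_sqr => xab.
  rewrite ME (_ : 2 * dot w x - t = 0) ?mul0r ?scale0r ?subr0 //.
  move: xab; rewrite /t /w !(dotDr, dotNr, dotC (_ - _), dotC (_ + _)).
  by rewrite (dotC a x) (dotC b x) (dotC b a) => xab; lra.
Qed.

(* The points are matched one at a time: the reflection in the bisector of the
   current image of p k and of q k fixes the points matched before. *)
Lemma congruent_of_dist n (p q : 'I_n -> 'cV[R]_m) :
  (forall i j, dist (p i) (p j) = dist (q i) (q j)) ->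
  exists (M : 'M[R]_m) (T : 'cV[R]_m),
    orthogonal_mx M /\ forall i, M *m p i + T = q i.
Proof.
move=> pq; suff H k : exists (M : 'M[R]_m) (T : 'cV[R]_m),
    orthogonal_mx M /\ forall i : 'I_n, (i < k)%N -> M *m p i + T = q i.
  by have [M [T [hM h]]] := H n; exists M, T; split=> // i; apply: h.
elim: k => [|k [M [T [hM h]]]].
  by exists 1%:M, 0; split; rewrite // /orthogonal_mx trmx1 mulmx1.
have [kn|nk] := ltnP k n; last first.
  by exists M, T; split=> // i _; apply: h; apply: leq_trans nk.
pose c := Ordinal kn.
have [N [S [hN Nc Nfix]]] := bisector_reflection (M *m p c + T) (q c).
exists (N *m M), (N *m T + S); split=> [|i]; first exact: orthogonal_mxM.
rewrite -mulmxA addrA -mulmxDr ltnS leq_eqVlt => /orP[/eqP ik|ik].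
  by rewrite (_ : i = c) //; apply: val_inj.
(* A point [q i] already matched is the current image of [p i], hence as far from the image of [p c]
   as [p i] is from [p c], that is, as [q i] is from [q c]: it lies on the bisector. *)
by rewrite h // Nfix // -[in LHS]h // dist_rigid.
Qed.
End Euclid.

(** * Edges of the complete graph and their lengths *)

Lemma eq_set2 (T : finType) (x y z t : T) :
  ([set x; y] == [set z; t]) =
  ((x == z) && (y == t)) || ((x == t) && (y == z)).
Proof.
apply/eqP/orP => [/setP E|[]/andP[/eqP-> /eqP->] //]; last exact: setUC.
have := And4 (E x) (E y) (E z) (E t); rewrite !inE !eqxx ?orbT /= => -[].
rewrite !(eq_sym z) !(eq_sym t) => xzt yzt xyz xyt.
apply/orP; move: xzt yzt xyz xyt.
by case: (x == z); case: (x == t); case: (y == z); case: (y == t).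
Qed.

Lemma mem_pairs n (A : {set 'I_n}) : (A \in pairs n) = (#|A| == 2%N).
Proof.
apply/imset2P/cards2P => [[i j _]|[i [j [ij ->]]]]; last by exists i j; rewrite ?inE.
by rewrite inE => ij ->; exists i, j.
Qed.

Lemma dist_set2 (R : realType) m n (p : 'I_n -> 'cV[R]_m) i j k l :
  [set i; j] = [set k; l] -> dist (p i) (p j) = dist (p k) (p l).
Proof.
move/eqP; rewrite eq_set2 => /orP[]/andP[/eqP-> /eqP->] //; exact: dist_sym.
Qed.

(** The reindexing of increasing pairs is carried over to edges along [E]. The map [psi] goes from
    edges of [q] to edges of [p], since the vanishing of [g] is known on [q] and its nonvanishing is
    assumed on [p]. *)
Lemma same_distribution_edge_bijection (R : realType) m n
    (p q : 'I_n -> 'cV[R]_m) :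
  same_distribution p q ->
  exists psi : {set 'I_n} -> {set 'I_n},
    [/\ forall A : {set 'I_n}, #|A| = 2%N -> #|psi A| = 2%N,
        forall A B : {set 'I_n}, #|A| = 2%N -> #|B| = 2%N ->
          psi A = psi B -> A = B &
        forall i j k l, i != j -> psi [set i; j] = [set k; l] ->
          dist (q i) (q j) = dist (p k) (p l)].
Proof.
rewrite /same_distribution /distances.
set s := enum _ => /(perm_map_reindex (enum_uniq _))[phi [phis phi_inj phi_dist]].
pose E (ij : 'I_n * 'I_n) := [set ij.1; ij.2].
(* The default [set0] is never reached on a two-element set, which always comes from an increasing
   pair. *)
pose psi (A : {set 'I_n}) := if [pick ij | (ij \in s) && (E ij == A)] is Some ij
  then E (phi ij) else set0.
have sE ij : (ij \in s) = (ij.1 < ij.2)%N by rewrite mem_enum.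
have E2 ij : ij \in s -> #|E ij| = 2%N.
  by rewrite sE cards2 => /ltn_eqF; rewrite -val_eqE => ->.
have E_inj : {in s &, injective E}.
  move=> [i j] [k l]; rewrite !sE /= => ij kl /eqP; rewrite eq_set2 /=.
  case/orP=> /andP[/eqP ik /eqP jl]; subst i j => //.
  by have := ltn_trans ij kl; rewrite ltnn.
have psiP (A : {set 'I_n}) : #|A| = 2%N ->
    exists ij, [/\ ij \in s, E ij = A & psi A = E (phi ij)].
  move=> A2; rewrite /psi; case: pickP => [ij /andP[ijs /eqP <-]|no].
    by exists ij.
  have /eqP/cards2P[i [j [ij AE]]] := A2.
  have [lt_ij|lt_ji|/val_inj eq_ij] := ltngtP i j.
  - by have := no (i, j); rewrite sE /E AE lt_ij eqxx.
  - by have := no (j, i); rewrite sE /E AE lt_ji setUC eqxx.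
  - by rewrite eq_ij eqxx in ij.
exists psi; split=> [A /psiP[ij [ijs _ ->]]|A B|i j k l].
- by rewrite E2 ?phis.
- move=> /psiP[ij [ijs <- ->]] /psiP[kl [kls <- ->]].
  by move=> /E_inj/phi_inj->; rewrite ?phis.
- move=> ij; have [|ab [abs Eab ->]] := psiP [set i; j].
    by rewrite cards2 ij.
  move=> /(dist_set2 p) <-; rewrite -(dist_set2 q Eab).
  exact: phi_dist.
Qed.

Theorem theorem1p3 (R : realType) (n : nat) (hn : (5 <= n)%N)
    (p : 'I_n -> 'cV[R]_2)
    (d := fun i j : 'I_n => dist (p i) (p j) ^+ 2)
    (hg : forall i0 i1 i2 j1 j2 k1 k2 l1 l2 m1 m2 : 'I_n,
       let s := [:: [set i0; i1]; [set i0; i2]; [set j1; j2];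
                    [set k1; k2]; [set l1; l2]; [set m1; m2]] in
       {subset s <= pairs n} -> uniq s ->
       g (d i0 i1) (d j1 j2) (d k1 k2) (d l1 l2) (d m1 m2) (d i0 i2) != 0) :
  reconstructible p.
Proof.
move=> q /same_distribution_edge_bijection[psi [psi2 psi_inj psi_dist]].
have c2 (x y : 'I_n) : x != y -> #|[set x; y]| = 2%N by rewrite cards2 => ->.
have disj (A B : {set 'I_n}) : #|A| = 2%N -> #|B| = 2%N -> [disjoint A & B] ->
    [disjoint psi A & psi B].
  move=> A2 B2 dAB; apply: contraT => /pred0Pn[i0 /andP[/= iA iB]].
  have [i1 _ EA] := cards2_mem (psi2 _ A2) iA.
  have [i2 _ EB] := cards2_mem (psi2 _ B2) iB.
  have /eqP/cards2P[a [b [ab AE]]] := A2; have /eqP/cards2P[c [e [ce BE]]] := B2.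
  have ne x y : x \in A -> y \in B -> x != y.
    move=> xA yB; apply: contraTneq dAB => E.
    by apply/pred0Pn; exists x; rewrite /= xA E.
  have [aA bA] : a \in A /\ b \in A by rewrite AE !inE !eqxx orbT.
  have [cB eB] : c \in B /\ e \in B by rewrite BE !inE !eqxx orbT.
  have [ac ae] := (ne _ _ aA cB, ne _ _ aA eB).
  have [bc be] := (ne _ _ bA cB, ne _ _ bA eB).
  have /eqP/cards2P[j1 [j2 [_ Ej]]] := psi2 _ (c2 _ _ ac).
  have /eqP/cards2P[k1 [k2 [_ Ek]]] := psi2 _ (c2 _ _ ae).
  have /eqP/cards2P[l1 [l2 [_ El]]] := psi2 _ (c2 _ _ bc).
  have /eqP/cards2P[m1 [m2 [_ Em]]] := psi2 _ (c2 _ _ be).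
  (* The six edges on the points [a], [b], [c], [e], with the opposite edges [A] and [B] first.
     Their images under [psi] are the six edges fed to [hg]: those of [A] and [B] share [i0], the
     other four are unconstrained. *)
  pose s := [:: A; B; [set a; c]; [set a; e]; [set b; c]; [set b; e]].
  have s2 X : X \in s -> #|X| = 2%N.
    by rewrite !inE => /or4P[/eqP->|/eqP->|/eqP->|/or3P[]/eqP->] //; apply: c2.
  have := hg i0 i1 i2 j1 j2 k1 k2 l1 l2 m1 m2.
  rewrite /= -EA -EB -Ej -Ek -El -Em => /(_ _ _)/negP[].
  - rewrite -[X in {subset X <= _}]/(map psi s) => _ /mapP[X Xs ->].
    by rewrite mem_pairs psi2 ?s2.
  - rewrite -[X in is_true X]/(uniq (map psi s)) map_inj_in_uniq => [|X Y Xs Ys].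
      rewrite /s AE BE /= !inE !eq_set2 !eqxx.
      rewrite (eq_sym b a) (eq_sym c a) (eq_sym e a) (eq_sym c b) (eq_sym e b).
      by rewrite !(negbTE ab, negbTE ac, negbTE ae, negbTE bc, negbTE be,
        negbTE ce).
    by apply: psi_inj; apply: s2.
  (* Each length in [p] becomes the length in [q] of the edge it came from, which turns the value of
     [g] into the planar one. *)
  rewrite /d -(psi_dist a b i0 i1) -?AE // -(psi_dist c e i0 i2) -?BE //.
  rewrite -(psi_dist a c j1 j2) // -(psi_dist a e k1 k2) //.
  rewrite -(psi_dist b c l1 l2) // -(psi_dist b e m1 m2) // !dist_sqr /dot.
  by rewrite !big_ord_recl !big_ord0 !mxE !addr0 -!expr2 g_planar.
have [|pi piP] := edge_perm_vertex_perm _ psi2 psi_inj disj.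
  by rewrite card_ord.
(* [pi] relabels points of [q] by those of [p]; the permutation sought runs from [p] to [q], hence
   the inverse. *)
have pq i j : dist (p i) (p j) = dist (q (pi^-1%g i)) (q (pi^-1%g j)).
  have [->|ij] := eqVneq i j; first by rewrite /dist !subrr.
  have ij' : pi^-1%g i != pi^-1%g j by rewrite (inj_eq perm_inj).
  by apply/esym/psi_dist; rewrite // piP // !permKV.
have [M [T [hM h]]] := congruent_of_dist pq.
by exists M, T, pi^-1%g.
Qed.
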